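(* Let $k$ be even and let $(\Gamma;\vec{j'})$ be a colored graph. The map $$F:\mathcal H(\Gamma;\vec{j'})\to H^1(\Gamma;\vec{j'}),\qquad F([\delta]_\Gamma)=[\delta],$$ sending the $\sim_\Gamma$-equivalence class of a twisted 1-cocycle $\delta$ to its cohomology class, is a (well-defined) group isomorphism.
   Context: Fix an even positive integer $k$ (the level) and a commutative ring $R$ with unit; $R^\times$ is its group of units. A unitrivalent graph is a finite graph (loops and multiple edges allowed) all of whose vertices are trivalent or univalent. Let $\Gamma$ be a unitrivalent graph with $3g-3+2n$ edges $\{f_l\}$, $2g-2+n$ trivalent vertices and $n$ univalent vertices $w_1,\dots,w_n$, the edges being numbered so that $f_1,\dots,f_n$ are the edges incident to $w_1,\dots,w_n$. $H_1(\Gamma)$ denotes homology with $\mathbb Z/2$ coefficients, $H_1(\Gamma)\cong(\mathbb Z/2)^g$; an element $\lambda\in H_1(\Gamma)$ is a mod 2 cycle, identified with the set of edges lying on it. A colored graph is a pair $(\Gamma;\vec{j'})$ with $\vec{j'}=(j'_1,\dots,j'_n)\in\{0,\frac12,\dots,\frac k2\}^n$. (For the pieces of decompositions below, which may be disconnected or empty, all definitions are used verbatim; for the empty graph, $QCG_k$ is a one-point set and $H_1=0$.) $QCG_k(\Gamma;\vec{j'})$ is the set of admissible colorings of level $k$: maps $\vec j=(j_l):\{f_l\}\to\{0,\frac12,\dots,\frac k2\}$, $j_l:=\vec j(f_l)$, with $j_l=j'_l$ for $l=1,\dots,n$, such that at each trivalent vertex with incident edges $f_{i_1},f_{i_2},f_{i_3}$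 one has $j_{i_1}+j_{i_2}+j_{i_3}\in\mathbb Z$, $|j_{i_1}-j_{i_2}|\le j_{i_3}\le j_{i_1}+j_{i_2}$ and $j_{i_1}+j_{i_2}+j_{i_3}\le k$ (for a vertex with a loop, $f_{i_2}=f_{i_3}$ and the conditions are read with $j_{i_2}=j_{i_3}$). $H_1(\Gamma)$ acts on $QCG_k(\Gamma;\vec{j'})$: $\lambda\cdot\vec j$ is obtained from $\vec j$ by replacing $j_l$ with $\frac k2-j_l$ for every edge $f_l$ lying on $\lambda$, and leaving the other entries unchanged. Put $A(\Gamma;\vec{j'}):=(R^\times)^{QCG_k(\Gamma;\vec{j'})}$, with $H_1(\Gamma)$-action $\lambda:(c_{\vec j})\mapsto(c_{\lambda\cdot\vec j})$. $H^*(\Gamma;\vec{j'})$ is the group cohomology $H^*(H_1(\Gamma);A(\Gamma;\vec{j'}))$ (coefficients written multiplicatively). Explicitly, a twisted 1-cocycle is a map $\delta=(\delta_{\vec j}):H_1(\Gamma)\to A(\Gamma;\vec{j'})$ with $\delta_{\vec j}(\lambda+\lambda')=\delta_{\lambda\cdot\vec j}(\lambda')\,\delta_{\vec j}(\lambda)$ (the group of these is $Z^1(\Gamma;\vec{j'})$), and a coboundary is one of the form $\delta_{\vec j}(\lambda)=c_{\lambda\cdot\vec j}\,c_{\vec j}^{-1}$ for some $(c_{\vec j})\in A(\Gamma;\vec{j'})$. Representations: $R(\Gamma;\vec{j'})$ is the free $R$-module with basis $\{|\vec j\rangle : \vec j\in QCG_k(\Gamma;\vec{j'})\}$. A twisted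 1-cocycle $\delta$ defines a representation $\rho(\delta):H_1(\Gamma)\to GL(R(\Gamma;\vec{j'}))$, $\rho(\delta)(\lambda)|\vec j\rangle:=\delta_{\vec j}(\lambda)|\lambda\cdot\vec j\rangle$. Decompositions: cut each of finitely many (possibly zero) internal edges of $\Gamma$ (edges not incident to a univalent vertex) into two edges, each ending at a new univalent vertex, and write the resulting graph as a disjoint union $\Gamma_1\sqcup\Gamma_2$ of unions of connected components ($\Gamma_1$ or $\Gamma_2$ may be empty; the two halves of a cut edge may lie in the same piece). Let $\vec{j''}$ be a coloring of the cut edges by elements of $\{0,\frac12,\dots,\frac k2\}$, and let $\vec{j'_i}$ be the coloring of the univalent vertices of $\Gamma_i$ given by the values of $\vec{j'}\cup\vec{j''}$ (both halves of a cut edge receive its $\vec{j''}$-value). Then $(\Gamma_1;\vec{j'_1})$ and $(\Gamma_2;\vec{j'_2})$ are said to be a decomposition of $(\Gamma;\vec{j'})$. For $\vec j\in QCG_k(\Gamma_2;\vec{j'_2})$, gluing colorings gives an inclusion $\iota_{\vec j}:QCG_k(\Gamma_1;\vec{j'_1})\times\{\vec j\}\hookrightarrow QCG_k(\Gamma;\vec{j'})$, hence a projection $\iota_{\vec j}^*:A(\Gamma;\vec{j'})\to A(\Gamma_1;\vec{j'_1})$; together with the inclusion $H_1(\Gamma_1)\hookrightarrow H_1(\Gamma)$ this induces maps $\iota^*_{\vec j}$ on twisted cochains and on cohomology, given on 1-cocycles by $(\iota_{\vec j}^*\delta)_{\vec j_1}(\lambda)=\delta_{\iota_{\vec j}(\vec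 j_1)}(\lambda)$ for $\lambda\in H_1(\Gamma_1)$. For twisted 1-cocycles $\delta,\delta'$ of $(\Gamma;\vec{j'})$ write $\delta\sim_\Gamma\delta'$ if for every decomposition $(\Gamma_1;\vec{j'_1})$, $(\Gamma_2;\vec{j'_2})$ of $(\Gamma;\vec{j'})$ and every $\vec j\in QCG_k(\Gamma_2;\vec{j'_2})$, the representations $\rho(\iota^*_{\vec j}(\delta))$ and $\rho(\iota^*_{\vec j}(\delta'))$ of $H_1(\Gamma_1)$ on $R(\Gamma_1;\vec{j'_1})$ are isomorphic. This is an equivalence relation; $[\delta]_\Gamma$ is the class of $\delta$, $\mathcal H(\Gamma;\vec{j'})$ is the set of equivalence classes, with group structure induced from $Z^1(\Gamma;\vec{j'})$: $[\delta]_\Gamma\cdot[\delta']_\Gamma:=[\delta\delta']_\Gamma$. *)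

(* Defs.v *)
From HB Require Import structures.
From mathcomp Require Import all_boot all_order all_algebra.
From mathcomp Require Import boolp ring lra.

Set Implicit Arguments.
Unset Strict Implicit.
Unset Printing Implicit Defensive.

Import Order.TTheory GRing.Theory Num.Theory.
Local Open Scope ring_scope.
Local Open Scope quotient_scope.

(* Each edge [e] has the two half-edges [(e, false)] and [(e, true)], attached
   to vertices by [ends]; loops and multiple edges are allowed.  The resulting
   orientation of the edges plays no role. *)
Record mgraph := MGraph {
  vert : finType;
  edge : finType;
  ends : edge * bool -> vert }.

Definition decide (T : Type) (b : bool) (ft : b -> T) (ff : ~~ b -> T) : T :=
  match boolP b with AltTrue h => ft h | AltFalse h => ff h end.

Lemma decideP (T : Type) (P : T -> Prop) (b : bool) (ft : b -> T) (ff : ~~ b -> T) :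
  (forall h, P (ft h)) -> (forall h, P (ff h)) -> P (decide ft ff).
Proof.
move=> Pt Pf; exact: (match boolP b as p return
  P (match p with AltTrue h => ft h | AltFalse h => ff h end)
  with AltTrue h => Pt h | AltFalse h => Pf h end).
Qed.

Lemma decideT (T : Type) (b : bool) (ft : b -> T) (ff : ~~ b -> T) (h : b) :
  decide ft ff = ft h.
Proof.
elim/decideP: (decide _ _) => h'; first by rewrite (bool_irrelevance h' h).
by case/negP: (h').
Qed.

Lemma decideF (T : Type) (b : bool) (ft : b -> T) (ff : ~~ b -> T) (h : ~~ b) :
  decide ft ff = ff h.
Proof.
elim/decideP: (decide _ _) => h'; last by rewrite (bool_irrelevance h' h).
by case/negP: (h).
Qed.

Section Graph.
Variable G : mgraph.

Definition star (v : vert G) : {set edge G * bool} := [set h | ends h == v].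
Definition univalent (v : vert G) : bool := #|star v| == 1%N.
Definition trivalent (v : vert G) : bool := #|star v| == 3.
Definition unitrivalent : bool := [forall v, univalent v || trivalent v].
Definition internal (e : edge G) : bool :=
  ~~ univalent (ends (e, false)) && ~~ univalent (ends (e, true)).

Definition chain1 := {ffun edge G -> 'F_2}.
Definition boundary (c : chain1) : {ffun vert G -> 'F_2} :=
  [ffun v => \sum_(h in star v) c h.1].
Definition is_cycle : pred chain1 := fun c => boundary c == 0.

(* H_1(G; Z/2): a graph has no 2-cells, so this is the group of 1-cycles. *)
Record homology1 := Homology1 {
  cycle_chain : chain1;
  cycle_chainP : is_cycle cycle_chain }.

HB.instance Definition _ := [isSub for cycle_chain].
HB.instance Definition _ := [Finite of homology1 by <:].

Lemma is_cycle_zmod_closed : zmod_closed is_cycle.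
Proof.
split=> [|x y /eqP hx /eqP hy].
  by apply/eqP/ffunP=> v; rewrite !ffunE big1 // => h _; rewrite ffunE.
apply/eqP/ffunP=> v; move/ffunP/(_ v): hx; move/ffunP/(_ v): hy.
rewrite !ffunE => hy hx.
by under eq_bigr do rewrite !ffunE; rewrite sumrB hx hy subrr.
Qed.

HB.instance Definition _ :=
  GRing.isZmodClosed.Build chain1 is_cycle is_cycle_zmod_closed.
HB.instance Definition _ := [SubChoice_isSubZmodule of homology1 by <:].

Definition on_cycle (x : homology1) (e : edge G) : bool := cycle_chain x e == 1.

End Graph.

Definition unitrivalent_graph (g n : nat) (G : mgraph) : Prop :=
  [/\ unitrivalent G,
      (#|edge G| + 3 = 3 * g + 2 * n)%N,
      (#|[set v : vert G | trivalent v]| + 2 = 2 * g + n)%N,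
      #|[set v : vert G | univalent v]| = n
    & exists f : {additive homology1 G -> 'rV['F_2]_g}, bijective f].

(* The color set {0, 1/2, ..., k/2}: [a : color k] stands for [spin a = a/2]. *)
Definition color (k : nat) := 'I_k.+1.
Definition spin (k : nat) (a : color k) : rat := (a : nat)%:R / 2%:R.
Definition flip (k : nat) (a : color k) : color k := rev_ord a.

Lemma spin_flip k (a : color k) : spin (flip a) = k%:R / 2%:R - spin a.
Proof.
by rewrite /spin /= subSS natrB ?mulrBl // -ltnS.
Qed.

Definition admissible3 (k : nat) (a b c : color k) : bool :=
  [&& spin a + spin b + spin c \is a Num.int,
      `|spin a - spin b| <= spin c,
      spin c <= spin a + spin b
    & spin a + spin b + spin c <= k%:R].

Section Colorings.
Variables (k : nat) (G : mgraph).

(* Only the values of [j'] at the univalent vertices are used. *)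
Definition admissible_at (j' : vert G -> color k) (c : {ffun edge G -> color k})
    (v : vert G) : bool :=
  (univalent v ==> [forall h in star v, c h.1 == j' v]) &&
  (trivalent v ==>
    [forall h1 in star v, [forall h2 in star v, [forall h3 in star v,
      uniq [:: h1; h2; h3] ==> admissible3 (c h1.1) (c h2.1) (c h3.1)]]]).

Definition admissible (j' : vert G -> color k) :
    pred {ffun edge G -> color k} := fun c => [forall v, admissible_at j' c v].

Variable j' : vert G -> color k.

Record QCG := MkQCG {
  coloring : {ffun edge G -> color k};
  coloringP : admissible j' coloring }.

HB.instance Definition _ := [isSub for coloring].
HB.instance Definition _ := [Finite of QCG by <:].

Lemma cycle_univalent (x : homology1 G) (h : edge G * bool) :
  univalent (ends h) -> cycle_chain x h.1 = 0.
Proof.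
case: x => c /= /eqP/ffunP/(_ (ends h)); rewrite !ffunE => hc.
move=> /cards1P[h0 hs]; move: hc; rewrite hs big_set1 => <-.
have : h \in star (ends h) by rewrite inE.
by rewrite hs inE => /eqP->.
Qed.

Lemma trivalent_star (v : vert G) h1 h2 h3 : trivalent v ->
  h1 \in star v -> h2 \in star v -> h3 \in star v -> uniq [:: h1; h2; h3] ->
  star v =i [:: h1; h2; h3].
Proof.
move=> /eqP tv i1 i2 i3 u; apply: fsym.
have sub : {subset [:: h1; h2; h3] <= enum (star v)}.
  by move=> h; rewrite mem_enum !inE => /or3P[]/eqP->; move: i1 i2 i3; rewrite !inE.
have [] := uniq_min_size u sub; first by rewrite -cardE tv.
by move=> _ e h; rewrite e mem_enum.
Qed.

Lemma cycle_trivalent (x : homology1 G) (v : vert G) h1 h2 h3 : trivalent v ->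
  h1 \in star v -> h2 \in star v -> h3 \in star v -> uniq [:: h1; h2; h3] ->
  cycle_chain x h1.1 + cycle_chain x h2.1 + cycle_chain x h3.1 = 0.
Proof.
move=> tv i1 i2 i3 u; case: x => c /= /eqP/ffunP/(_ v); rewrite !ffunE => <-.
rewrite (eq_bigl _ _ (trivalent_star tv i1 i2 i3 u)) -big_uniq //=.
by rewrite !big_cons big_nil addr0 addrA.
Qed.

Lemma F2_cases (a : 'F_2) : a = 0 \/ a = 1.
Proof. by case: a => [[|[|//]]] i; [left | right]; apply: val_inj. Qed.

Definition flip_along (x : homology1 G) (c : {ffun edge G -> color k}) :
    {ffun edge G -> color k} :=
  [ffun e => if on_cycle x e then flip (c e) else c e].

Lemma flip2_int (a b c : color k) :
  (spin (flip a) + spin (flip b) + spin c \is a Num.int) =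
  (spin a + spin b + spin c \is a Num.int).
Proof.
have -> : spin (flip a) + spin (flip b) + spin c =
  k%:R - (a : nat)%:R - (b : nat)%:R + (spin a + spin b + spin c).
  by rewrite !spin_flip /spin; field.
by rewrite rpredDl // !rpredB ?natr_int.
Qed.

Lemma admissible3_flip2 (a b c : color k) :
  admissible3 a b c -> admissible3 (flip a) (flip b) c.
Proof.
rewrite /admissible3 flip2_int !spin_flip => /and4P[-> + h2 h3] /=.
rewrite ler_norml => /andP[h4 h5]; rewrite ler_norml.
by apply/and3P; split; [apply/andP; split| |]; lra.
Qed.

Lemma admissible3_perm (a b c : color k) :
  admissible3 a b c -> admissible3 b c a.
Proof.
rewrite /admissible3 => /and4P[hi + h2 h3].
rewrite [X in X \is a _]addrC addrA hi /=.
rewrite !ler_norml => /andP[h4 h5].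
by apply/and3P; split; [apply/andP; split| |]; lra.
Qed.

Lemma flip_along_admissible (x : homology1 G) (j : QCG) :
  admissible j' (flip_along x (coloring j)).
Proof.
case: j => c /= /forallP hc; apply/forallP=> v.
move/andP: (hc v) => [h1 h3]; apply/andP; split.
  apply/implyP=> uv; apply/forall_inP=> h hv.
  rewrite ffunE /on_cycle; have /[dup] := hv; rewrite inE => /eqP e.
  rewrite cycle_univalent ?e // => _.
  by move/implyP: h1 => /(_ uv)/forall_inP/(_ h hv).
apply/implyP=> tv.
apply/forall_inP=> a av; apply/forall_inP=> b bv; apply/forall_inP=> d dv.
apply/implyP=> u.
have := cycle_trivalent x tv av bv dv u.
move/implyP: h3 => /(_ tv)/forall_inP/(_ a av)/forall_inP/(_ b bv).
move=> /forall_inP/(_ d dv)/implyP/(_ u); rewrite !ffunE /on_cycle.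
move: (cycle_chain x _) (cycle_chain x _) (cycle_chain x _) => r q p.
case: (F2_cases p) => ->; case: (F2_cases q) => ->; case: (F2_cases r) => -> //= A _.
- by apply/admissible3_perm/admissible3_perm/admissible3_flip2/admissible3_perm.
- by apply/admissible3_perm/admissible3_flip2/admissible3_perm/admissible3_perm.
- exact: admissible3_flip2.
Qed.

Definition act (x : homology1 G) (j : QCG) : QCG :=
  MkQCG (flip_along_admissible x j).

Lemma act0 (j : QCG) : act 0 j = j.
Proof.
apply: val_inj; apply/ffunP=> e.
by rewrite ffunE /on_cycle /= ffunE.
Qed.

Lemma flipK : involutive (@flip k).
Proof. exact: rev_ordK. Qed.

Lemma actD (x y : homology1 G) (j : QCG) : act (x + y) j = act y (act x j).
Proof.
apply: val_inj; apply/ffunP=> e; rewrite !ffunE /on_cycle /= !ffunE.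
by case: (F2_cases (cycle_chain x e)) => ->; case: (F2_cases (cycle_chain y e)) => -> //=; rewrite flipK.
Qed.

End Colorings.

(* [f] identifies the half-edges at [v1] with the half-edges at [v2]. *)
Section StarIso.
Variables (G1 G2 : mgraph) (f : edge G1 * bool -> edge G2 * bool).
Variables (v1 : vert G1) (v2 : vert G2).
Hypothesis f_inj : injective f.
Hypothesis f_star : star v2 = f @: star v1.

Lemma star_iso_univalent : univalent v2 = univalent v1.
Proof. by rewrite /univalent f_star card_imset. Qed.

Lemma star_iso_trivalent : trivalent v2 = trivalent v1.
Proof. by rewrite /trivalent f_star card_imset. Qed.

Lemma star_iso_boundary (x1 : chain1 G1) (x2 : chain1 G2) :
  (forall h, h \in star v1 -> x2 (f h).1 = x1 h.1) ->
  boundary x2 v2 = boundary x1 v1.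
Proof.
move=> e; rewrite !ffunE f_star big_imset; last by move=> ? ? _ _; apply: f_inj.
by apply: eq_bigr => h hv; rewrite e.
Qed.

Lemma star_iso_admissible k (j1 : vert G1 -> color k) (j2 : vert G2 -> color k)
    (c1 : {ffun edge G1 -> color k}) (c2 : {ffun edge G2 -> color k}) :
  j1 v1 = j2 v2 -> (forall h, h \in star v1 -> c2 (f h).1 = c1 h.1) ->
  admissible_at j1 c1 v1 -> admissible_at j2 c2 v2.
Proof.
move=> ej e /andP[/implyP u /implyP t]; apply/andP.
rewrite star_iso_univalent star_iso_trivalent; split.
  apply/implyP=> /u/forall_inP h1; apply/forall_inP=> h.
  by rewrite f_star => /imsetP[h' hv ->]; rewrite e // -ej h1.
apply/implyP=> /t/forall_inP h3.
apply/forall_inP=> a; rewrite f_star => /imsetP[a' av ->].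
apply/forall_inP=> b; move => /imsetP[b' bv ->].
apply/forall_inP=> d; move => /imsetP[d' dv ->].
rewrite !e // -[[:: f _; _; _]]/(map f [:: a'; b'; d']) map_inj_uniq //.
by move/forall_inP: (h3 a' av) => /(_ b' bv)/forall_inP/(_ d' dv).
Qed.

End StarIso.

(* Cut every edge [e] of [C]: the half [(e, s)] becomes the edge [inr (e, s)],
   joining the original vertex [ends (e, s)] to the new univalent vertex
   [inr (e, s)]. *)
Section Cut.
Variables (k : nat) (G : mgraph) (C : {set edge G}).

Definition cut_edge : finType := ({e | e \notin C} + {e | e \in C} * bool)%type.
Definition cut_vert : finType := (vert G + {e | e \in C} * bool)%type.
Definition cut_ends (h : cut_edge * bool) : cut_vert :=
  match h with
  | (inl e, s) => inl (ends (val e, s))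
  | (inr (e, s), false) => inl (ends (val e, s))
  | (inr (e, s), true) => inr (e, s)
  end.
Definition cut_graph : mgraph := MGraph cut_ends.

Definition cut_boundary (j' : vert G -> color k) (j'' : {e | e \in C} -> color k)
    (v : vert cut_graph) : color k :=
  match v with inl w => j' w | inr (e, _) => j'' e end.

End Cut.

(* [S] is a union of connected components iff no edge leaves [S]. *)
Definition union_of_components (G : mgraph) (S : {set vert G}) : Prop :=
  forall e : edge G, (ends (e, false) \in S) = (ends (e, true) \in S).

Section Subgraph.
Variables (G : mgraph) (S : {set vert G}).
Hypothesis SC : union_of_components S.

Definition sub_edge : finType := {e : edge G | ends (e, false) \in S}.

Lemma sub_endsP (e : sub_edge) (s : bool) : ends (val e, s) \in S.
Proof. by case: s; [rewrite -SC|]; exact: (valP e). Qed.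

Definition subgraph : mgraph :=
  @MGraph {v | v \in S} sub_edge
    (fun h => exist _ (ends (val h.1, h.2)) (sub_endsP h.1 h.2)).

End Subgraph.

Lemma union_of_componentsC (G : mgraph) (S : {set vert G}) :
  union_of_components S -> union_of_components (~: S).
Proof. by move=> SC e; rewrite !in_setC SC. Qed.

Section SubgraphTheory.
Variables (G : mgraph) (S : {set vert G}) (SC : union_of_components S).

Definition sub_half (h : edge (subgraph SC) * bool) : edge G * bool :=
  (val h.1, h.2).

Lemma sub_half_inj : injective sub_half.
Proof. by move=> [e s] [e' s'] [/val_inj -> ->]. Qed.

Lemma ends_sub_half h : ends (sub_half h) = val (ends h).
Proof. by []. Qed.

Lemma sub_star (v : vert (subgraph SC)) : star (val v) = sub_half @: star v.
Proof.
apply/setP=> [[e s]]; apply/idP/imsetP => [|[h]]; last first.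
  by rewrite !inE => /eqP <- ->.
rewrite inE => /eqP ev.
have eS : ends (e, false) \in S.
  have := valP v; rewrite -ev; by case: s {ev}; rewrite -?SC.
exists (exist _ e eS, s) => //; rewrite inE; apply/eqP/val_inj.
by rewrite -ends_sub_half.
Qed.

End SubgraphTheory.

Section Merge.
Variables (G : mgraph) (S : {set vert G}) (SC : union_of_components S).
Let G1 := subgraph SC.
Let G2 := subgraph (union_of_componentsC SC).

Lemma notin_setC (x : vert G) : x \notin S -> x \in ~: S.
Proof. by rewrite in_setC. Qed.

Definition merge (T : Type) (f1 : edge G1 -> T) (f2 : edge G2 -> T)
    (e : edge G) : T :=
  @decide T (ends (e, false) \in S)
    (fun h => f1 (exist _ e h)) (fun h => f2 (exist _ e (notin_setC h))).

Lemma merge1 (T : Type) f1 f2 (e : edge G1) : @merge T f1 f2 (val e) = f1 e.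
Proof. by rewrite /merge (decideT _ _ (valP e)); congr f1; apply: val_inj. Qed.

Lemma merge2 (T : Type) f1 f2 (e : edge G2) : @merge T f1 f2 (val e) = f2 e.
Proof.
have h : ends (val e, false) \notin S by have := valP e; rewrite in_setC.
by rewrite /merge (decideF _ _ h); congr f2; apply: val_inj.
Qed.

Lemma merge_admissible k (j : vert G -> color k) (c1 : {ffun edge G1 -> color k})
    (c2 : {ffun edge G2 -> color k}) :
  admissible (fun v : vert G1 => j (val v)) c1 ->
  admissible (fun v : vert G2 => j (val v)) c2 ->
  admissible j [ffun e => merge c1 c2 e].
Proof.
move=> /forallP a1 /forallP a2; apply/forallP=> v.
have [vS|/notin_setC vS] := boolP (v \in S).
  apply: (star_iso_admissible (@sub_half_inj _ _ SC)
    (sub_star (exist _ v vS : vert G1)) _ _ (a1 _)) => //.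
  by move=> h _; rewrite ffunE merge1.
apply: (star_iso_admissible (@sub_half_inj _ _ _)
  (sub_star (exist _ v vS : vert G2)) _ _ (a2 _)) => //.
by move=> h _; rewrite ffunE merge2.
Qed.

Lemma merge_cycle (x1 : chain1 G1) (x2 : chain1 G2) :
  is_cycle x1 -> is_cycle x2 -> is_cycle [ffun e => merge x1 x2 e].
Proof.
move=> /eqP a1 /eqP a2; apply/eqP/ffunP=> v; rewrite [RHS]ffunE.
have [vS|/notin_setC vS] := boolP (v \in S).
  rewrite (star_iso_boundary (@sub_half_inj _ _ SC)
    (sub_star (exist _ v vS : vert G1)) (x1 := x1)) ?a1 ?ffunE //.
  by move=> h _; rewrite ffunE merge1.
rewrite (star_iso_boundary (@sub_half_inj _ _ _)
  (sub_star (exist _ v vS : vert G2)) (x1 := x2)) ?a2 ?ffunE //.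
by move=> h _; rewrite ffunE merge2.
Qed.

End Merge.

Section Uncut.
Variables (G : mgraph) (C : {set edge G}).
Let GC := cut_graph C.

Definition uncut (T : Type) (f : edge GC -> T) (fC : {e | e \in C} -> T)
    (e : edge G) : T :=
  @decide T (e \in C) (fun h => fC (exist _ e h)) (fun h => f (inl (exist _ e h))).

Definition cut_half (h : edge G * bool) : edge GC * bool :=
  @decide (edge GC * bool) (h.1 \in C)
    (fun H => (inr (exist _ h.1 H, h.2), false))
    (fun H => (inl (exist _ h.1 H), h.2)).

Variant cut_half_spec (h : edge G * bool) : edge GC * bool -> Prop :=
| CutHalfIn (e : {e | e \in C}) of h.1 = val e :
    cut_half_spec h (inr (e, h.2), false)
| CutHalfOut (e : {e | e \notin C}) of h.1 = val e :
    cut_half_spec h (inl e, h.2).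

Lemma cut_halfP h : cut_half_spec h (cut_half h).
Proof.
by rewrite /cut_half; elim/decideP: (decide _ _) => H; constructor.
Qed.

Lemma cut_halfT (e : {e | e \in C}) s : cut_half (val e, s) = (inr (e, s), false).
Proof.
by rewrite /cut_half (decideT _ _ (valP e)); congr (inr (_, _), _); apply: val_inj.
Qed.

Lemma cut_halfF (e : {e | e \notin C}) s : cut_half (val e, s) = (inl e, s).
Proof.
by rewrite /cut_half (decideF _ _ (valP e)); congr (inl _, _); apply: val_inj.
Qed.

Lemma uncutT T f fC (e : {e | e \in C}) : @uncut T f fC (val e) = fC e.
Proof. by rewrite /uncut (decideT _ _ (valP e)); congr fC; apply: val_inj. Qed.

Lemma uncutF T f fC (e : {e | e \notin C}) : @uncut T f fC (val e) = f (inl e).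
Proof.
by rewrite /uncut (decideF _ _ (valP e)); congr (f (inl _)); apply: val_inj.
Qed.

Lemma cut_half_inj : injective cut_half.
Proof.
move=> [e s] [e' s'].
case: cut_halfP => a /= ->; case: cut_halfP => b /= -> E;
  by inversion_clear E.
Qed.

Lemma ends_cut_half h : ends (cut_half h) = inl (ends h).
Proof. by case: h => e s; case: cut_halfP => a /= ->. Qed.

Lemma cut_star (v : vert G) : star (inl v : vert GC) = cut_half @: star v.
Proof.
apply/setP=> h; apply/idP/imsetP => [|[h' + ->]]; last first.
  by rewrite !inE ends_cut_half => /eqP->.
rewrite inE; case: h => [[e|[e s]] [|]] //= /eqP[ev].
- by exists (val e, true); rewrite ?inE ?ev // cut_halfF.
- by exists (val e, false); rewrite ?inE ?ev // cut_halfF.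
- by exists (val e, s); rewrite ?inE ?ev // cut_halfT.
Qed.

Lemma cut_star_new (x : {e | e \in C} * bool) :
  star (inr x : vert GC) = [set (inr x, true)].
Proof.
apply/setP; case=> [[e|[e s]] [|]]; rewrite !inE; case: x => e' s';
  first [by [] | by apply/eqP/eqP => E; inversion_clear E | by apply/negP => /eqP].
Qed.

Lemma univalent_new (x : {e | e \in C} * bool) : univalent (inr x : vert GC).
Proof. by rewrite /univalent cut_star_new cards1. Qed.

Lemma uncut_half (T : Type) f fC (h : edge G * bool) :
  (forall x, f (inr x) = fC x.1) -> @uncut T f fC h.1 = f (cut_half h).1.
Proof.
by move=> e; case: cut_halfP => a -> /=; rewrite ?uncutT ?uncutF ?e.
Qed.

Lemma uncut_admissible k (j' : vert G -> color k) (j'' : {e | e \in C} -> color k)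
    (c : {ffun edge GC -> color k}) :
  admissible (cut_boundary j' j'') c -> admissible j' [ffun e => uncut c j'' e].
Proof.
move=> /forallP a; apply/forallP=> v.
have ec x : c (inr x) = j'' x.1.
  have /andP[/implyP/(_ (univalent_new x))/forall_inP/(_ (inr x, true)) + _] :=
    a (inr x).
  by rewrite cut_star_new inE eqxx => /(_ isT)/eqP ->; case: x.
have /andP[/implyP h1 /implyP h3] := a (inl v).
rewrite /admissible_at -!(star_iso_univalent cut_half_inj (cut_star v)).
rewrite -!(star_iso_trivalent cut_half_inj (cut_star v)).
have hS h : h \in star v -> cut_half h \in star (inl v : vert GC).
  by rewrite !inE ends_cut_half => /eqP->.
apply/andP; split; apply/implyP.
  move=> /h1/forall_inP uv; apply/forall_inP=> h hv.
  by rewrite ffunE uncut_half // (uv _ (hS _ hv)).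
move=> /h3/forall_inP tv; apply/forall_inP=> p pv.
apply/forall_inP=> q qv; apply/forall_inP=> r rv.
rewrite !ffunE !uncut_half //; apply/implyP => u.
move/forall_inP: (tv _ (hS _ pv)) => /(_ _ (hS _ qv))/forall_inP/(_ _ (hS _ rv)).
move/implyP; apply.
by rewrite -[[:: cut_half _; _; _]]/(map cut_half [:: p; q; r]) map_inj_uniq //;
  apply: cut_half_inj.
Qed.

Lemma uncut_cycle (x : chain1 GC) :
  is_cycle x -> is_cycle [ffun e => uncut x (fun=> 0) e].
Proof.
move=> xc; have ec y : x (inr y) = 0.
  by case: y => e s; apply: (@cycle_univalent _ (Homology1 xc) (inr (e, s), true) (univalent_new (e, s))).
move: xc => /eqP a; apply/eqP/ffunP=> v; rewrite [RHS]ffunE.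
have : boundary x (inl v) = 0 by rewrite a ffunE.
rewrite (star_iso_boundary cut_half_inj (cut_star v)
  (x1 := [ffun e => uncut x (fun=> 0) e])) //.
by move=> h _; rewrite ffunE uncut_half.
Qed.

End Uncut.

(* [Gamma_1] and [Gamma_2] are the subgraphs of [cut_graph cut] on [piece] and
   on its complement; both halves of a cut edge get its color [cut_color]. *)
Record decomposition (k : nat) (G : mgraph) := Decomposition {
  cut : {set edge G};
  cut_internal : forall e, e \in cut -> internal e;
  cut_color : {e | e \in cut} -> color k;
  piece : {set vert (cut_graph cut)};
  piece_closed : union_of_components piece }.

Arguments cut_color {k G} d _.
Arguments piece_closed {k G} d _.

Section Pieces.
Variables (k : nat) (G : mgraph) (j' : vert G -> color k) (D : decomposition k G).

Definition piece1 : mgraph := subgraph (piece_closed D).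
Definition piece2 : mgraph := subgraph (union_of_componentsC (piece_closed D)).
Definition boundary_color1 (v : vert piece1) : color k :=
  cut_boundary j' (cut_color D) (val v).
Definition boundary_color2 (v : vert piece2) : color k :=
  cut_boundary j' (cut_color D) (val v).

(* Cut edges get the color prescribed by the decomposition, which is also the
   color of their two halves. *)
Definition glue (j2 : QCG boundary_color2) (j1 : QCG boundary_color1) : QCG j' :=
  MkQCG (uncut_admissible (merge_admissible (coloringP j1) (coloringP j2))).

(* A cycle avoids the cut edges, since their halves have a univalent end. *)
Definition cycle_inclusion (x : homology1 piece1) : homology1 G :=
  Homology1 (uncut_cycle
    (merge_cycle (cycle_chainP x) (cycle_chainP (0 : homology1 piece2)))).

Lemma cycle_inclusionD : {morph cycle_inclusion : x y / x + y}.
Proof.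
move=> x y; apply/val_inj/ffunP=> e; rewrite !ffunE /uncut.
case/orP: (orbN (e \in cut D)) => H; first by rewrite !(decideT _ _ H) addr0.
rewrite !(decideF _ _ H) !ffunE /merge.
case/orP: (orbN (ends (inl (exist _ e H) : edge (cut_graph (cut D)), false)
  \in piece D)) => K; first by rewrite !(decideT _ _ K) ffunE.
by rewrite !(decideF _ _ K) !ffunE addr0.
Qed.

Lemma glue_act (j2 : QCG boundary_color2) x (j1 : QCG boundary_color1) :
  glue j2 (act x j1) = act (cycle_inclusion x) (glue j2 j1).
Proof.
apply/val_inj/ffunP=> e; rewrite !ffunE /on_cycle /= !ffunE /uncut.
case/orP: (orbN (e \in cut D)) => H; first by rewrite !(decideT _ _ H).
rewrite !(decideF _ _ H) !ffunE /merge.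
case/orP: (orbN (ends (inl (exist _ e H) : edge (cut_graph (cut D)), false)
  \in piece D)) => K; first by rewrite !(decideT _ _ K) ffunE.
by rewrite !(decideF _ _ K) !ffunE.
Qed.

End Pieces.

Lemma abelian_divM (H : groupType) (HC : forall x y : H, commute x y)
  (a b c d : H) : ((a * b) / (c * d) = (a / c) * (b / d))%g.
Proof.
rewrite invgM -!mulgA; congr (_ * _)%g.
by rewrite [RHS]HC -mulgA.
Qed.

Record runit (R : comUnitRingType) := RUnit {
  runit_val : R;
  runit_valP : runit_val \is a GRing.unit }.

Section UnitGroup.
Variable R : comUnitRingType.

HB.instance Definition _ := [isSub for @runit_val R].
HB.instance Definition _ := [Choice of runit R by <:].

Definition runit_one : runit R := RUnit (unitr1 R).
Definition runit_mul (u v : runit R) : runit R :=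
  RUnit (rpredM (runit_valP u) (runit_valP v)).
Definition runit_inv (u : runit R) : runit R :=
  RUnit (rpredVr (runit_valP u)).

Lemma runit_mulA : associative runit_mul.
Proof. by move=> u v w; apply: val_inj; rewrite /= mulrA. Qed.
Lemma runit_mulC : commutative runit_mul.
Proof. by move=> u v; apply: val_inj; rewrite /= mulrC. Qed.
Lemma runit_mul1 : left_id runit_one runit_mul.
Proof. by move=> u; apply: val_inj; rewrite /= mul1r. Qed.
Lemma runit_1mul : right_id runit_one runit_mul.
Proof. by move=> u; apply: val_inj; rewrite /= mulr1. Qed.
Lemma runit_mulV : left_inverse runit_one runit_inv runit_mul.
Proof. by move=> u; apply: val_inj; rewrite /= mulVr ?runit_valP. Qed.
Lemma runit_Vmul : right_inverse runit_one runit_inv runit_mul.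
Proof. by move=> u; apply: val_inj; rewrite /= mulrV ?runit_valP. Qed.

HB.instance Definition _ := isGroup.Build (runit R)
  runit_mulA runit_mul1 runit_1mul runit_mulV runit_Vmul.

Lemma runit_comm (u v : runit R) : commute u v.
Proof. exact: runit_mulC. Qed.

End UnitGroup.

Section Cohomology.
Variables (k : nat) (R : comUnitRingType) (G : mgraph) (j' : vert G -> color k).

Definition coefficients := {ffun QCG j' -> runit R}.
Definition cochain1 := {ffun homology1 G -> coefficients}.

Lemma cochain1_comm (d d' : cochain1) : commute d d'.
Proof. by apply/ffunP=> x; apply/ffunP=> j; rewrite !ffunE; apply: runit_comm. Qed.

(* Twisted cocycles for the action (x . c)_j = c_(x . j) on [coefficients]. *)
Definition is_cocycle : pred cochain1 := fun d =>
  [forall x, forall y, forall j, d (x + y) j == (d y (act x j) * d x j)%g].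

Lemma is_cocycleP (d : cochain1) :
  reflect (forall x y j, d (x + y) j = (d y (act x j) * d x j)%g) (is_cocycle d).
Proof.
apply: (iffP forallP) => [h x y j|h x].
  by move/forallP: (h x) => /(_ y)/forallP/(_ j)/eqP.
by apply/forallP=> y; apply/forallP=> j; apply/eqP.
Qed.

Record cocycle1 := Cocycle1 { cochain : cochain1; cocycleP : is_cocycle cochain }.

HB.instance Definition _ := [isSub for cochain].
HB.instance Definition _ := [Choice of cocycle1 by <:].

Lemma is_cocycle_group_closed : group_closed is_cocycle.
Proof.
split=> [|d d' /is_cocycleP dP /is_cocycleP d'P]; apply/is_cocycleP => x y j.
  by rewrite !ffunE mulg1.
by rewrite !ffunE dP d'P (abelian_divM (@runit_comm R)).
Qed.

HB.instance Definition _ :=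
  SubChoice_isSubGroup.Build cochain1 is_cocycle cocycle1 is_cocycle_group_closed.

Definition is_coboundary (d : cocycle1) : Prop :=
  exists c : coefficients, forall x j, cochain d x j = (c (act x j) * (c j)^-1)%g.

Definition cohomologous : rel cocycle1 := fun d d' => `[< is_coboundary (d / d')%g >].

Lemma is_coboundaryM (d d' : cocycle1) :
  is_coboundary d -> is_coboundary d' -> is_coboundary (d * d')%g.
Proof.
move=> [c hc] [c' hc']; exists (c * c')%g => x j.
by rewrite !ffunE hc hc' (abelian_divM (@runit_comm R)).
Qed.

Lemma is_coboundaryV (d : cocycle1) : is_coboundary d -> is_coboundary (d^-1)%g.
Proof.
move=> [c hc]; exists (c^-1)%g => x j.
by rewrite !ffunE hc invgM invgK runit_comm.
Qed.

Lemma is_coboundary1 : is_coboundary 1%g.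
Proof. by exists 1%g => x j; rewrite !ffunE mulgV. Qed.

Lemma cocycle1_comm (d d' : cocycle1) : commute d d'.
Proof. by apply: val_inj; apply: cochain1_comm. Qed.

Lemma cohomologous_equiv : equiv_class_of cohomologous.
Proof.
split=> [d|d d'|d' d d'']; first by apply/asboolP; rewrite mulgV; apply: is_coboundary1.
  by apply/asboolP/asboolP => /is_coboundaryV; rewrite invgF.
move=> /asboolP h /asboolP h'; apply/asboolP.
by have := is_coboundaryM h h'; rewrite mulgA mulgVK.
Qed.

Canonical cohomologous_equiv_rel := EquivRelPack cohomologous_equiv.
Canonical cohomologous_encModRel := defaultEncModRel cohomologous.

(* H^1(H_1(G); coefficients) = Z^1 / B^1 *)
Definition cohomology1 := {eq_quot cohomologous}.

HB.instance Definition _ : EqQuotient _ cohomologous cohomology1 :=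
  EqQuotient.on cohomology1.
HB.instance Definition _ := Choice.on cohomology1.

Definition cohomology1_one : cohomology1 := lift_cst cohomology1 1%g.
Definition cohomology1_mul := lift_op2 cohomology1 (fun x y : cocycle1 => x * y)%g.
Definition cohomology1_inv := lift_op1 cohomology1 (fun x : cocycle1 => x^-1)%g.

Lemma pi_cohomology1_mul :
  {morph \pi_cohomology1 : x y / (x * y)%g >-> cohomology1_mul x y}.
Proof.
move=> d d'; unlock cohomology1_mul; apply/eqmodP/asboolP.
have /eqmodP/asboolP h := esym (reprK (\pi_cohomology1 d)).
have /eqmodP/asboolP h' := esym (reprK (\pi_cohomology1 d')).
by rewrite abelian_divM; [apply: is_coboundaryM | apply: cocycle1_comm].
Qed.

Lemma pi_cohomology1_inv :
  {morph \pi_cohomology1 : x / (x^-1)%g >-> cohomology1_inv x}.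
Proof.
move=> d; unlock cohomology1_inv; apply/eqmodP/asboolP.
have /eqmodP/asboolP h := esym (reprK (\pi_cohomology1 d)).
by have := is_coboundaryV h; rewrite invgM cocycle1_comm.
Qed.

Lemma pi_cohomology1_one : \pi_cohomology1 1%g = cohomology1_one.
Proof. by unlock cohomology1_one. Qed.

Lemma cohomology1_mulA : associative cohomology1_mul.
Proof.
move=> x y z; rewrite -[x]reprK -[y]reprK -[z]reprK.
by rewrite -!pi_cohomology1_mul mulgA.
Qed.
Lemma cohomology1_mul1 : left_id cohomology1_one cohomology1_mul.
Proof.
by move=> x; rewrite -[x]reprK -pi_cohomology1_one -pi_cohomology1_mul mul1g.
Qed.
Lemma cohomology1_1mul : right_id cohomology1_one cohomology1_mul.
Proof.
by move=> x; rewrite -[x]reprK -pi_cohomology1_one -pi_cohomology1_mul mulg1.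
Qed.
Lemma cohomology1_mulV :
  left_inverse cohomology1_one cohomology1_inv cohomology1_mul.
Proof.
move=> x; rewrite -[x]reprK -pi_cohomology1_inv -pi_cohomology1_mul mulVg.
exact: pi_cohomology1_one.
Qed.
Lemma cohomology1_Vmul :
  right_inverse cohomology1_one cohomology1_inv cohomology1_mul.
Proof.
move=> x; rewrite -[x]reprK -pi_cohomology1_inv -pi_cohomology1_mul mulgV.
exact: pi_cohomology1_one.
Qed.

HB.instance Definition _ := isGroup.Build cohomology1
  cohomology1_mulA cohomology1_mul1 cohomology1_1mul
  cohomology1_mulV cohomology1_Vmul.

End Cohomology.

Record representation (H : zmodType) (R : comUnitRingType) (V : lmodType R) :=
  Representation {
    rep : H -> {linear V -> V};
    rep0 : forall v, rep 0 v = v;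
    repD : forall x y v, rep (x + y) v = rep x (rep y v) }.

Definition rep_isomorphic (H : zmodType) (R : comUnitRingType) (V W : lmodType R)
    (r : representation H V) (s : representation H W) : Prop :=
  exists2 f : {linear V -> W}, bijective f & forall x v, f (rep r x v) = rep s x (f v).

Lemma rep_isomorphic_refl (H : zmodType) (R : comUnitRingType) (V : lmodType R)
  (r : representation H V) : rep_isomorphic r r.
Proof. by exists idfun => //; exists idfun. Qed.

Lemma rep_isomorphic_sym (H : zmodType) (R : comUnitRingType) (V W : lmodType R)
    (r : representation H V) (s : representation H W) :
  rep_isomorphic r s -> rep_isomorphic s r.
Proof.
move=> [f [g fK gK] fr].
have glin : linear g.
  by move=> a u v; apply: (can_inj fK); rewrite linearP !gK.
pose L := GRing.isLinear.Build R W V *:%R g glin.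
pose g' : {linear W -> V} := HB.pack g L.
exists g'; first by exists f.
by move=> x w; apply: (can_inj fK); rewrite fr /= !gK.
Qed.

Lemma rep_isomorphic_trans (H : zmodType) (R : comUnitRingType)
    (V W X : lmodType R) (r : representation H V) (s : representation H W)
    (t : representation H X) :
  rep_isomorphic r s -> rep_isomorphic s t -> rep_isomorphic r t.
Proof.
move=> [f fb fr] [g gb gr]; exists (g \o f); first exact: bij_comp.
by move=> x v; rewrite /= fr gr.
Qed.

Section Rho.
Variables (k : nat) (R : comUnitRingType) (G : mgraph) (j' : vert G -> color k).

(* The free R-module on QCG, with basis [ket]. *)
Definition state_space := {ffun QCG j' -> R^o}.
HB.instance Definition _ := GRing.Lmodule.on state_space.

Definition ket (j : QCG j') : state_space := [ffun i => (i == j)%:R].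

Definition rho_fun (d : cocycle1 R j') (x : homology1 G) (v : state_space) :
    state_space :=
  \sum_j (v j * runit_val (cochain d x j)) *: ket (act x j).

Lemma rho_fun_linear d x : linear (rho_fun d x).
Proof.
move=> a u v; rewrite /rho_fun scaler_sumr -big_split /=.
by apply: eq_bigr => j _; rewrite !ffunE scalerA -scalerDl mulrDl mulrA.
Qed.

HB.instance Definition _ d x :=
  GRing.isLinear.Build R state_space state_space *:%R (rho_fun d x)
    (rho_fun_linear d x).

Lemma rho_fun_ket d x j :
  rho_fun d x (ket j) = runit_val (cochain d x j) *: ket (act x j).
Proof.
rewrite /rho_fun (bigD1 j) //= ffunE eqxx mul1r big1 ?addr0 // => i ij.
by rewrite ffunE (negPf ij) mul0r scale0r.
Qed.

Lemma state_ket (v : state_space) : v = \sum_j v j *: ket j.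
Proof.
apply/ffunP=> i; rewrite sum_ffunE (bigD1 i) //= !ffunE eqxx.
rewrite big1 ?addr0 => [|j ji]; first by rewrite /GRing.scale /= mulr1.
by rewrite !ffunE eq_sym (negPf ji) scaler0.
Qed.

Lemma linear_ket_ext (f h : {linear state_space -> state_space}) :
  (forall j, f (ket j) = h (ket j)) -> f =1 h.
Proof.
move=> e v; rewrite [v]state_ket !linear_sum.
by apply: eq_bigr => j _; rewrite !linearZ /= e.
Qed.

Lemma rho_funD d x y v : rho_fun d (x + y) v = rho_fun d x (rho_fun d y v).
Proof.
apply: (@linear_ket_ext (rho_fun d (x + y)) (rho_fun d x \o rho_fun d y)) => j /=.
rewrite !rho_fun_ket linearZ /= rho_fun_ket scalerA addrC actD.
by rewrite (is_cocycleP _ (cocycleP d)) mulrC.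
Qed.

Lemma rho_fun0 d v : rho_fun d 0 v = v.
Proof.
apply: (@linear_ket_ext (rho_fun d 0) idfun) => j /=; rewrite rho_fun_ket act0.
suff -> : cochain d 0 j = 1%g by rewrite scale1r.
have := is_cocycleP _ (cocycleP d) 0 0 j; rewrite addr0 act0 => e.
by apply: (@mulgI _ (cochain d 0 j)); rewrite -e mulg1.
Qed.

Definition rho (d : cocycle1 R j') : representation (homology1 G) state_space :=
  @Representation (homology1 G) R state_space
    (fun x => rho_fun d x : {linear state_space -> state_space})
    (rho_fun0 d) (rho_funD d).

End Rho.

Section Main.
Variables (k : nat) (R : comUnitRingType) (G : mgraph) (j' : vert G -> color k).

Definition pullback_fun (D : decomposition k G) (j2 : QCG (boundary_color2 j' (D:=D)))
    (d : cochain1 R j') : cochain1 R (boundary_color1 j' (D:=D)) :=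
  [ffun x => [ffun j1 => d (cycle_inclusion x) (glue j2 j1)]].

Lemma pullback_cocycle (D : decomposition k G)
    (j2 : QCG (boundary_color2 j' (D:=D))) (d : cocycle1 R j') :
  is_cocycle (pullback_fun j2 (cochain d)).
Proof.
apply/is_cocycleP=> x y j1; rewrite !ffunE cycle_inclusionD glue_act.
exact: is_cocycleP (cocycleP d) _ _ _.
Qed.

Definition pullback (D : decomposition k G) (j2 : QCG (boundary_color2 j' (D:=D)))
    (d : cocycle1 R j') : cocycle1 R (boundary_color1 j' (D:=D)) :=
  Cocycle1 (pullback_cocycle j2 d).

(* The relation is not decidable in general, so it is made boolean classically
   in order to form the quotient. *)
Definition sim : rel (cocycle1 R j') := fun d d' =>
  `[< forall (D : decomposition k G) (j2 : QCG (boundary_color2 j' (D:=D))),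
        rep_isomorphic (rho (pullback j2 d)) (rho (pullback j2 d')) >].

Lemma sim_equiv : equiv_class_of sim.
Proof.
split=> [d|d d'|d' d d''].
- by apply/asboolP=> D j2; apply: rep_isomorphic_refl.
- by apply/asboolP/asboolP=> h D j2; apply: rep_isomorphic_sym.
- move=> /asboolP h /asboolP h'; apply/asboolP=> D j2.
  exact: rep_isomorphic_trans (h D j2) (h' D j2).
Qed.

Canonical sim_equiv_rel := EquivRelPack sim_equiv.
Canonical sim_encModRel := defaultEncModRel sim.

Definition calH := {eq_quot sim}.

HB.instance Definition _ : EqQuotient _ sim calH := EqQuotient.on calH.
HB.instance Definition _ := Choice.on calH.

End Main.

Definition is_group_law (T : Type) (mul : T -> T -> T) : Prop :=
  associative mul /\
  exists one inv, [/\ left_id one mul, right_id one mul,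
    left_inverse one inv mul & right_inverse one inv mul].

(* Main.v *)
Require Import Defs.
From mathcomp Require Import all_boot all_order all_algebra.
From HB Require Import structures.
From mathcomp Require Import boolp.
Import GRing.Theory.
Local Open Scope ring_scope.
Local Open Scope quotient_scope.

Set Implicit Arguments.
Unset Strict Implicit.
Unset Printing Implicit Defensive.

(** The two equivalence relations on twisted cocycles are the same one, so the
identity of cocycles descends to a bijection of the quotients, and the group
structure of cohomology can be carried back along it.

If two cocycles [d], [d'] differ by the coboundary of [c], then multiplying
each basis vector [ket j] by the inverse of [c j] intertwines [rho d] and
[rho d'].  Coboundaries pull back to coboundaries along every decomposition,
so [d] and [d'] are related by [sim].

Conversely, a cocycle with values indexed by an [H_1]-set is a coboundary as
soon as it is trivial on stabilizers (Shapiro's lemma in degree one,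
[coboundary_of_stabilizers]).  It is therefore enough to recover, from the
isomorphism classes of the representations, each value [d x j] with [x] fixing
[j].  The trace of [rho d x] is the sum of the [d x i] over all colorings [i]
fixed by [x], which mixes the values at different [i].  A decomposition
isolates one of them: cut every internal edge off [x], color the cuts by [j],
and keep everything in the first piece.  All edges off [x] then end at a
univalent vertex, so their color is prescribed, and an edge on [x] carries in
any coloring fixed by [x] the only color invariant under the flip.  Hence [x]
has a single fixed coloring, the restriction of [j], and the trace on the piece
is exactly [d x j] ([sim_stabilizer]). *)

(** * Traces *)

Section Trace.
Variables (k : nat) (R : comUnitRingType) (G : mgraph) (j' : vert G -> color k).
Local Notation V := (state_space R j').

Definition ket_trace (f : V -> V) : R := \sum_j f (ket R j) j.

Lemma ket_traceE (f g : {linear V -> V}) :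
  ket_trace (f \o g) = \sum_j \sum_i g (ket R j) i * f (ket R i) j.
Proof.
apply: eq_bigr => j _ /=; rewrite [g _ in LHS]state_ket linear_sum sum_ffunE.
by apply: eq_bigr => i _; rewrite linearZ ffunE.
Qed.

Lemma ket_traceC (f g : {linear V -> V}) :
  ket_trace (f \o g) = ket_trace (g \o f).
Proof.
rewrite !ket_traceE exchange_big; apply: eq_bigr => j _.
by apply: eq_bigr => i _; rewrite mulrC.
Qed.

Lemma rep_isomorphic_trace (H : zmodType) (r s : representation H V) :
  rep_isomorphic r s -> forall x, ket_trace (rep r x) = ket_trace (rep s x).
Proof.
move=> [f [g fK gK] fr] x.
have glin : linear g.
  by move=> a u v; apply: (can_inj fK); rewrite linearP !gK.
pose g' : {linear V -> V} :=
  HB.pack g (GRing.isLinear.Build R V V *:%R g glin).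
have -> : ket_trace (rep r x) = ket_trace (g' \o (f \o rep r x)).
  by apply: eq_bigr => j _; rewrite /= fK.
rewrite (ket_traceC g' (f \o rep r x)).
by apply: eq_bigr => j _; rewrite /= fr gK.
Qed.

(** In the basis of kets, [rho d x] is a monomial matrix: only the fixed points
of [x] contribute to the diagonal. *)
Lemma rho_trace (d : cocycle1 R j') x :
  ket_trace (rep (rho d) x) = \sum_(j | act x j == j) runit_val (cochain d x j).
Proof.
rewrite [RHS]big_mkcond; apply: eq_bigr => j _ /=.
rewrite rho_fun_ket !ffunE eq_sym /GRing.scale /=.
by case: eqP => _; rewrite ?mulr1 ?mulr0.
Qed.

Lemma rho_trace1 (d : cocycle1 R j') x j :
  act x j = j -> (forall i, act x i = i -> i = j) ->
  ket_trace (rep (rho d) x) = runit_val (cochain d x j).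
Proof.
move=> xj uj; rewrite rho_trace (big_pred1 j) // => i.
by apply/eqP/eqP => [|->//]; apply: uj.
Qed.

End Trace.

(** * Coboundaries *)

Section Coboundary.
Variables (k : nat) (R : comUnitRingType) (G : mgraph) (j' : vert G -> color k).
Implicit Types (d : cocycle1 R j') (x y : homology1 G) (j : QCG j').

Lemma cocycleE d x y j :
  cochain d (x + y) j = (cochain d y (act x j) * cochain d x j)%g.
Proof. exact: (is_cocycleP _ (cocycleP d)). Qed.

Lemma actNK x j : act (- x) (act x j) = j.
Proof. by rewrite -actD subrr act0. Qed.

(** The two cycles differ by an element of the stabilizer of the common image. *)
Lemma cocycle_eq_act d :
  (forall x j, act x j = j -> cochain d x j = 1%g) ->
  forall x y j, act x j = act y j -> cochain d x j = cochain d y j.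
Proof.
move=> d1 x y j exy; have ey : y = x + (y - x) by rewrite addrC subrK.
rewrite [in RHS]ey cocycleE (d1 (y - x)) ?mul1g //.
by rewrite -actD -ey.
Qed.

(** Shapiro's lemma in degree one.  A primitive [c] is found by transporting
along orbits: fix a base point [r j] in the orbit of [j] and a cycle [t j]
taking it to [j], and let [c j] be the value of [d] on this path.  Triviality on
stabilizers makes the value independent of the path, so that going through [j]
to [act x j] multiplies it by [d x j]. *)
Lemma coboundary_of_stabilizers d :
  (forall x j, act x j = j -> cochain d x j = 1%g) -> is_coboundary d.
Proof.
move=> d1.
pose orb j : pred (QCG j') := [pred i | [exists x, act x j == i]].
have orb_refl j : orb j j by apply/existsP; exists 0; rewrite act0.
have orb_act x j : orb (act x j) =1 orb j.
  move=> i; apply/existsP/existsP => -[y /eqP <-].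
    by exists (x + y); rewrite actD.
  by exists (- x + y); rewrite actD actNK.
pose r j := choose (orb j) j.
have r_act x j : r (act x j) = r j.
  (* [choose] returns the same point for extensionally equal predicates *)
  rewrite /r (eq_choose (orb_act x j)); apply: choose_id => //.
  by rewrite -(orb_act x j).
have to_r j : exists x, act x (r j) == j.
  have /existsP[x /eqP <-] : orb j (r j) by apply: chooseP.
  by exists (- x); rewrite actNK.
pose t j := xchoose (to_r j).
have tP j : act (t j) (r j) = j by apply/eqP/(xchooseP (to_r j)).
exists [ffun j => cochain d (t j) (r j)] => x j; rewrite !ffunE r_act.
rewrite (cocycle_eq_act d1 (x := t (act x j)) (y := t j + x)); last first.
  by rewrite actD tP -(r_act x j) tP.
by rewrite cocycleE tP mulgK.
Qed.

End Coboundary.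

(** * Cutting off the support of a cycle *)

(** Only the middle color, of spin [k / 4], can be fixed by the flip. *)
Lemma flip_fixed_inj k (a b : color k) : flip a = a -> flip b = b -> a = b.
Proof.
have half (c : color k) : flip c = c -> (c.*2 = k)%N.
  move/(congr1 val); rewrite /= subSS => e.
  by rewrite -addnn -{1}e subnK // -ltnS.
by move=> /half ea /half eb; apply/val_inj/double_inj; rewrite ea eb.
Qed.

Lemma coloring_univalent k (G : mgraph) (j' : vert G -> color k) (c : QCG j') h :
  univalent (ends h) -> coloring c h.1 = j' (ends h).
Proof.
move=> uh; have /forallP/(_ (ends h))/andP[/implyP/(_ uh) + _] := coloringP c.
by move/forall_inP => /(_ h); rewrite inE eqxx => /(_ isT)/eqP.
Qed.

Section SupportDecomposition.
Variables (k : nat) (G : mgraph) (j' : vert G -> color k).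
Variables (x : homology1 G) (j : QCG j').

Definition off_support : {set edge G} :=
  [set e | internal e && ~~ on_cycle x e].

Lemma off_support_internal e : e \in off_support -> internal e.
Proof. by rewrite inE => /andP[]. Qed.

Lemma setT_union_of_components (H : mgraph) : union_of_components [set: vert H].
Proof. by move=> e; rewrite !inE. Qed.

(** The first piece is the whole cut graph.  Components that [x] does not meet
could go to the second piece, but in the first piece they only add edges
of prescribed color, which do not affect the count of fixed colorings. *)
Definition support_decomposition : decomposition k G :=
  Decomposition off_support_internal (fun e => coloring j (val e))
    (@setT_union_of_components (cut_graph off_support)).
Local Notation D := support_decomposition.

Lemma piece2_empty (v : vert (piece2 D)) : False.
Proof. by have := valP v; rewrite !inE. Qed.

Lemma piece2_admissible :
  admissible (boundary_color2 j' (D := D)) [ffun=> ord0].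
Proof. by apply/forallP=> v; case: (piece2_empty v). Qed.

Definition piece2_coloring : QCG (boundary_color2 j' (D := D)) :=
  MkQCG piece2_admissible.

Definition uncut_edge (e : cut_edge off_support) : edge G :=
  match e with inl a => val a | inr (a, _) => val a end.

(** Both halves of a cut edge receive the value of the edge; used for colors as
well as for [Z/2]-chains. *)
Definition piece1_restrict (T : Type) (f : edge G -> T) (e : edge (piece1 D)) : T :=
  f (uncut_edge (val e)).

Lemma uncut_edge_half (h : edge G * bool) :
  uncut_edge (cut_half off_support h).1 = h.1.
Proof. by case: cut_halfP. Qed.

Definition piece1_vert (v : vert (cut_graph off_support)) : vert (piece1 D) :=
  exist _ v (in_setT v).

Lemma piece1_vertP (v : vert (piece1 D)) : v = piece1_vert (val v).
Proof. exact: val_inj. Qed.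

Definition piece1_edge (e : edge (cut_graph off_support)) : edge (piece1 D) :=
  exist _ e (in_setT _).

Definition piece1_half (h : edge G * bool) : edge (piece1 D) * bool :=
  let h' := cut_half off_support h in (piece1_edge h'.1, h'.2).

Lemma piece1_half_inj : injective piece1_half.
Proof.
move=> h h' [e1 e2]; apply: (@cut_half_inj _ off_support).
by move: e1 e2; case: (cut_half _ h) => ? ?; case: (cut_half _ h') => ? ? /= -> ->.
Qed.

Lemma piece1_star (v : vert G) :
  star (piece1_vert (inl v)) = piece1_half @: star v.
Proof.
have S := sub_star (piece1_vert (inl v)).
apply: (imset_inj (@sub_half_inj _ _ (piece_closed D))).
rewrite -S cut_star -imset_comp; apply: eq_imset => h.
by rewrite /= /sub_half /=; case: (cut_half _ h).
Qed.

Lemma piece1_star_new y :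
  star (piece1_vert (inr y)) = [set (piece1_edge (inr y), true)].
Proof.
have S := sub_star (piece1_vert (inr y)).
apply: (imset_inj (@sub_half_inj _ _ (piece_closed D))).
by rewrite -S cut_star_new imset_set1.
Qed.

(** [x] vanishes on the cut edges, so nothing reaches the new univalent
vertices. *)
Lemma piece1_chain_cycle :
  is_cycle [ffun e => piece1_restrict (cycle_chain x) e].
Proof.
apply/eqP/ffunP=> v; rewrite [RHS]ffunE (piece1_vertP v).
case: (val v) => [w|y].
  rewrite (star_iso_boundary piece1_half_inj (piece1_star w)
    (x1 := cycle_chain x)); first by rewrite (eqP (cycle_chainP x)) ffunE.
  by move=> h _; rewrite ffunE /piece1_restrict uncut_edge_half.
rewrite ffunE piece1_star_new big_set1 ffunE /piece1_restrict /=.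
case: y => [[e /= eC] s]; move: eC; rewrite inE /on_cycle => /andP[_].
by case: (F2_cases (cycle_chain x e)) => ->.
Qed.

Definition piece1_cycle : homology1 (piece1 D) := Homology1 piece1_chain_cycle.

Lemma piece1_admissible : admissible (boundary_color1 j' (D := D))
  [ffun e => piece1_restrict (coloring j) e].
Proof.
apply/forallP=> v; rewrite (piece1_vertP v); case: (val v) => [w|y].
  apply: (star_iso_admissible piece1_half_inj (piece1_star w)
    (j1 := j') (c1 := coloring j)) => //.
    by move=> h _; rewrite ffunE /piece1_restrict uncut_edge_half.
  by have /forallP := coloringP j.
rewrite /admissible_at /trivalent piece1_star_new cards1 andbT.
apply/implyP=> _; apply/forall_inP=> h; rewrite inE => /eqP->.
by rewrite ffunE; case: y.
Qed.

Definition piece1_coloring : QCG (boundary_color1 j' (D := D)) :=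
  MkQCG piece1_admissible.

Lemma merge_restrict (T : Type) (f : edge G -> T) f2 e :
  Defs.merge (SC := piece_closed D) (piece1_restrict f) f2 e = f (uncut_edge e).
Proof.
by rewrite -[e in LHS]/(val (piece1_edge e)) merge1.
Qed.

Lemma glue_piece : glue piece2_coloring piece1_coloring = j.
Proof.
apply/val_inj/ffunP=> e; rewrite ffunE /uncut.
elim/decideP: (decide _ _) => // H.
rewrite ffunE -[RHS]/((coloring j) (uncut_edge (inl (exist _ e H)))).
rewrite -(@merge_restrict _ (coloring j) (coloring piece2_coloring)) /Defs.merge.
by elim/decideP: (decide _ _) => K;
  rewrite ?(decideT _ _ K) ?(decideF _ _ K) /= ?ffunE.
Qed.

Lemma cycle_inclusion_piece : cycle_inclusion piece1_cycle = x.
Proof.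
apply/val_inj/ffunP=> e; rewrite ffunE /uncut.
elim/decideP: (decide _ _) => H.
  move: (H); rewrite inE /on_cycle => /andP[_].
  by case: (F2_cases (cycle_chain x e)) => ->.
rewrite ffunE -[RHS]/((cycle_chain x) (uncut_edge (inl (exist _ e H)))).
rewrite -(@merge_restrict _ (cycle_chain x) (fun=> 0)) /Defs.merge.
by elim/decideP: (decide _ _) => K;
  rewrite ?(decideT _ _ K) ?(decideF _ _ K) /= ?ffunE.
Qed.

(** This is what the choice of the cuts is for: the color of an edge off [x] is
forced by a univalent vertex, either new or present from the start. *)
Lemma off_cycle_univalent (e : edge (piece1 D)) :
  ~~ on_cycle x (uncut_edge (val e)) -> exists s, univalent (ends (e, s)).
Proof.
have -> : e = piece1_edge (val e) by apply: val_inj.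
case: (val e) => [a|y] xa; last first.
  exists true; rewrite /univalent.
  rewrite (_ : ends _ = piece1_vert (inr y)); last by apply: val_inj; case: y {xa}.
  by rewrite piece1_star_new cards1.
have := valP a; rewrite inE xa andbT negb_and !negbK => ua.
suff [s us] : exists s, univalent (ends (val a, s)).
  exists s; rewrite (_ : ends _ = piece1_vert (inl (ends (val a, s)))).
    by rewrite (star_iso_univalent piece1_half_inj (piece1_star _)).
  exact: val_inj.
by case/orP: ua; [exists false | exists true].
Qed.

Hypothesis xj : act x j = j.

Lemma piece1_coloring_fixed : act piece1_cycle piece1_coloring = piece1_coloring.
Proof.
apply/val_inj/ffunP=> e; rewrite !ffunE /on_cycle /= !ffunE /piece1_restrict.
have /(congr1 (fun i : QCG j' => coloring i (uncut_edge (val e)))) := xj.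
by rewrite ffunE.
Qed.

Lemma piece1_fixed_unique (i : QCG (boundary_color1 j' (D := D))) :
  act piece1_cycle i = i -> i = piece1_coloring.
Proof.
move=> xi; apply/val_inj/ffunP=> e /=.
have [xe|/off_cycle_univalent[s us]] := boolP (on_cycle x (uncut_edge (val e))).
  have fix_flip (c : QCG (boundary_color1 j' (D := D))) :
      act piece1_cycle c = c -> flip (coloring c e) = coloring c e.
    move/(congr1 (fun i : QCG _ => coloring i e)).
    by rewrite ffunE /on_cycle /= ffunE -/(on_cycle x _) xe.
  exact: flip_fixed_inj (fix_flip _ xi) (fix_flip _ piece1_coloring_fixed).
by rewrite (coloring_univalent i us) (coloring_univalent piece1_coloring us).
Qed.

End SupportDecomposition.

(** * Comparison of the two equivalence relations *)

Section Comparison.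
Variables (k : nat) (R : comUnitRingType) (G : mgraph) (j' : vert G -> color k).
Implicit Types d : cocycle1 R j'.

(** On the cut graph the trace of the cycle has a single term, the value of the
cocycle at [x] and [j]. *)
Lemma sim_stabilizer d d' x j :
  sim d d' -> act x j = j -> cochain d x j = cochain d' x j.
Proof.
move=> /asboolP dd' xj; apply/val_inj.
have := rep_isomorphic_trace (dd' _ (piece2_coloring x j)) (piece1_cycle x j).
rewrite !(rho_trace1 _ (piece1_coloring_fixed xj) (piece1_fixed_unique xj)).
by rewrite !ffunE cycle_inclusion_piece glue_piece.
Qed.

(** The intertwiner is the diagonal matrix with entries the inverses of the
[c j]. *)
Lemma cohomologous_rep_isomorphic (c : coefficients R j') d d' :
  (forall x j, cochain (d / d')%g x j = (c (act x j) * (c j)^-1)%g) ->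
  rep_isomorphic (rho d) (rho d').
Proof.
move=> dd'.
pose f (v : state_space R j') : state_space R j' :=
  [ffun j => v j * runit_val (c j)^-1%g].
have flin : linear f.
  by move=> a u v; apply/ffunP=> j; rewrite !ffunE mulrDl -mulrA.
pose f' : {linear state_space R j' -> state_space R j'} :=
  HB.pack f (GRing.isLinear.Build R _ _ *:%R f flin).
pose g (v : state_space R j') : state_space R j' :=
  [ffun j => v j * runit_val (c j)].
exists f'.
  have cV (u : runit R) : runit_val u * runit_val u^-1%g = 1.
    exact: (congr1 (@runit_val R) (mulgV u)).
  exists g => v; apply/ffunP=> j; rewrite !ffunE -mulrA ?cV ?mulr1 //.
  by rewrite [X in _ * X]mulrC cV mulr1.
have fZ a v : f (a *: v) = a *: f v.
  by apply/ffunP=> j; rewrite !ffunE -mulrA.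
have fket i : f (ket R i) = runit_val (c i)^-1%g *: ket R i.
  apply/ffunP=> l; rewrite !ffunE /GRing.scale /= mulrC.
  by case: eqP => [->//|_]; rewrite !mulr0.
have dc x j : (cochain d x j * (c (act x j))^-1 = (c j)^-1 * cochain d' x j)%g.
  move: (dd' x j) => /(congr1 (fun u => u * cochain d' x j)%g).
  rewrite /= !ffunE mulgVK => ->.
  by rewrite runit_comm !mulgA mulVg mul1g.
move=> x; apply: (@linear_ket_ext _ _ _ _ (f' \o rep (rho d) x)
  (rep (rho d') x \o f')) => j.
rewrite -[LHS]/(f (rho_fun d x (ket R j))) -[RHS]/(rho_fun d' x (f (ket R j))).
rewrite rho_fun_ket fZ !fket [in RHS]linearZ /= rho_fun_ket !scalerA.
congr (_ *: _).
exact: (congr1 (@runit_val R) (dc x j)).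
Qed.

End Comparison.

Lemma sim_cohomologous k (R : comUnitRingType) (G : mgraph)
    (j' : vert G -> color k) (d d' : cocycle1 R j') :
  sim d d' = cohomologous d d'.
Proof.
apply/idP/idP => [dd'|/asboolP[c dd']].
  apply/asboolP/coboundary_of_stabilizers => x j xj.
  by rewrite !ffunE (sim_stabilizer dd' xj) mulgV.
apply/asboolP=> D j2.
pose cD : coefficients R (boundary_color1 j' (D := D)) :=
  [ffun j1 => c (glue j2 j1)].
apply: (cohomologous_rep_isomorphic (c := cD)) => x j1.
by rewrite !ffunE glue_act -dd' !ffunE.
Qed.

Lemma is_group_law_transport (T : Type) (H : groupType) (f : T -> H) (g : H -> T) :
  cancel f g -> cancel g f -> is_group_law (fun x y => g (f x * f y)%g).
Proof.
move=> fK gK; split=> [x y z|]; first by rewrite !gK mulgA.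
exists (g 1%g), (fun x => g (f x)^-1%g); split=> x.
- by rewrite gK mul1g fK.
- by rewrite gK mulg1 fK.
- by rewrite gK mulVg.
- by rewrite gK mulgV.
Qed.

Theorem theorem5p4 (k : nat) (k_gt0 : (0 < k)%N) (k_even : ~~ odd k)
    (R : comUnitRingType) (g n : nat) (G : mgraph)
    (HG : unitrivalent_graph g n G) (j' : vert G -> color k) :
  exists mulH : calH R j' -> calH R j' -> calH R j',
    [/\ forall d d' : cocycle1 R j',
          mulH (\pi_(calH R j') d) (\pi_(calH R j') d') =
          \pi_(calH R j') (d * d')%g,
        is_group_law mulH
      & exists F : calH R j' -> cohomology1 R j',
          [/\ forall d : cocycle1 R j',
                F (\pi_(calH R j') d) = \pi_(cohomology1 R j') d,
              {morph F : x y / mulH x y >-> (x * y)%g}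
            & bijective F]].
Proof.
(* The quotient maps are defined by choosing a representative; [F_pi] and
   [F'_pi] show that the choice does not matter. *)
pose F (a : calH R j') : cohomology1 R j' := \pi_(cohomology1 R j') (repr a).
pose F' (b : cohomology1 R j') : calH R j' := \pi_(calH R j') (repr b).
have F_pi d : F (\pi_(calH R j') d) = \pi_(cohomology1 R j') d.
  apply/eqmodP; rewrite /= -sim_cohomologous.
  by apply/eqmodP; rewrite reprK.
have F'_pi d : F' (\pi_(cohomology1 R j') d) = \pi_(calH R j') d.
  apply/eqmodP; rewrite /= sim_cohomologous.
  by apply/eqmodP; rewrite reprK.
have FK : cancel F F' by move=> a; rewrite -[a]reprK F_pi F'_pi.
have F'K : cancel F' F by move=> b; rewrite -[b]reprK F'_pi F_pi.
exists (fun a b => F' (F a * F b)%g); split.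
- by move=> d d'; rewrite !F_pi -F'_pi pi_cohomology1_mul.
- exact: is_group_law_transport.
- by exists F; split=> [//|a b|]; [rewrite F'K | exists F'].
Qed.
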